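(* In every bit-commitment based quantum coin flipping protocol, one of the two parties can achieve probability of cheating at least $9/16$. That is, for every such protocol there exist a party $X\in\{\text{Alice},\text{Bob}\}$, a value $v\in\{0,1\}$, and a cheating strategy for $X$ such that, when $X$ uses this strategy and the other party is honest, the outcome of the protocol is $c=v$ with probability at least $9/16$.
   Context: A bit-commitment based quantum coin flipping protocol is a two-party quantum communication protocol (all systems finite dimensional), with a finite number $n$ of rounds in which Alice and Bob alternately send messages, of the following form. Honest behaviour. Alice picks a uniformly random bit $a\in\{0,1\}$ and prepares a fixed (possibly mixed) state $\rho_a$ on a set of qubits; independently Bob picks a uniformly random bit $b\in\{0,1\}$ and prepares a fixed state $\sigma_b$ on a set of qubits. In each round the player whose turn it is sends a prescribed subset of the qubits of his or her state to the other player; what is sent does not depend on anything received from the other party. By the end of round $n$ all the qubits of $\rho_a$ have been sent to Bob, and all the qubits of $\sigma_b$ have been sent to Alice. The states $\rho_0,\rho_1$ are perfectly distinguishable (orthogonal supports), and so are $\sigma_0,\sigma_1$. After all communication, Bob measures the qubits received from Alice (possibly together with an ancilla in a fixed state) with a projective measurement $\{R_0,R_1,R_{\mathrm c}\}$, which on $\rho_a$ gives outcome $a$ with certainty; Alice measures the qubits received from Bob with an analogous projective measurement, which on $\sigma_b$ gives outcome $b$ with certainty. The outcome ''$\mathrm c$'' means that cheating has been detected. If no cheating is detected, the outcome of the protocol is $c=a\oplus b$, where an honest player uses his or her own bit and the bit obtained from the measurement of the other player's qubits. Cheating. A dishonest player may replace all of his or her local operations by arbitrary quantum operations on private workspace (of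 arbitrary finite dimension) and on all qubits received so far, subject only to sending messages of the prescribed size in the prescribed rounds. When one party is dishonest, ''the outcome is $c=v$'' means that the honest party detects no cheating and computes $c=v$. *)

(* Defs.v *)
From HB Require Import structures.
From mathcomp Require Import all_boot all_order all_algebra.
From mathcomp Require Export reals complex.

Set Implicit Arguments.
Unset Strict Implicit.
Unset Printing Implicit Defensive.

Import Order.TTheory GRing.Theory Num.Theory.
Local Open Scope ring_scope.
Local Open Scope sesquilinear_scope.

(* Operators on the Hilbert space C^T with orthonormal basis indexed by a
   finite type T; the space C^S (x) C^T is C^(S * T). *)
Definition op (C : numClosedFieldType) (T : finType) := 'M[C]_#|T|.

Definition entry (C : numClosedFieldType) (T : finType) (A : op C T) (x y : T)
  : C := A (enum_rank x) (enum_rank y).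

Definition mkop (C : numClosedFieldType) (T : finType) (f : T -> T -> C)
  : op C T := \matrix_(i, j) f (enum_val i) (enum_val j).

Lemma mkopE (C : numClosedFieldType) (T : finType) (f : T -> T -> C) x y :
  entry (mkop f) x y = f x y.
Proof. by rewrite /entry mxE !enum_rankK. Qed.

Definition tens (C : numClosedFieldType) (S T : finType)
    (A : op C S) (B : op C T) : op C (S * T)%type :=
  mkop (fun x y => entry A x.1 y.1 * entry B x.2 y.2).

(* Over a numClosedFieldType, 0 <= z entails that z is real, so that positive
   semidefinite operators are Hermitian. *)
Definition psd (C : numClosedFieldType) (T : finType) (A : op C T) : Prop :=
  forall v : 'cV[C]_#|T|, 0 <= (v^t* *m A *m v) 0 0.

Definition density (C : numClosedFieldType) (T : finType) (A : op C T)
  : Prop := psd A /\ \tr A = 1.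

(* The support of a density operator is its range. *)
Definition orthogonal_supports (C : numClosedFieldType) (T : finType)
    (A B : op C T) : Prop :=
  forall u v : 'cV[C]_#|T|, (A *m u)^t* *m (B *m v) = 0.

Definition projective_measurement (C : numClosedFieldType) (T O : finType)
    (M : O -> op C T) : Prop :=
  [/\ forall o, (M o)^t* = M o,
      forall o o', M o *m M o' = if o == o' then M o else 0
    & \sum_(o : O) M o = 1%:M].

(* Quantum operations are given by their operator-sum (Kraus) form. *)
Definition kraus_family (C : numClosedFieldType) (T : finType)
    (Ks : seq (op C T)) : Prop := \sum_(K <- Ks) K^t* *m K = 1%:M.

Definition kraus_apply (C : numClosedFieldType) (T : finType)
    (Ks : seq (op C T)) (rho : op C T) : op C T :=
  \sum_(K <- Ks) K *m rho *m K^t*.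

(* Computational basis of the qubits labelled by Q. *)
Definition qubits (Q : finType) : finType := {ffun Q -> bool}.

Definition restrict (Q : finType) (p : pred Q) (x : qubits Q)
  : qubits {q : Q | p q} := [ffun q => x (val q)].

(* K (x) 1, where K acts on W, the qubits of S in p and the qubits of T in r,
   and 1 is the identity on the remaining qubits of S and T. *)
Definition embed (C : numClosedFieldType) (W S T : finType)
    (p : pred S) (r : pred T)
    (K : op C (W * qubits {q : S | p q} * qubits {q : T | r q})%type)
  : op C (W * qubits S * qubits T)%type :=
  mkop (fun x y : W * qubits S * qubits T =>
    if [forall q, ~~ p q ==> (x.1.2 q == y.1.2 q)]
       && [forall q, ~~ r q ==> (x.2 q == y.2 q)]
    then entry K (x.1.1, restrict p x.1.2, restrict r x.2)
                 (y.1.1, restrict p y.1.2, restrict r y.2)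
    else 0).

Definition trace_out_ends (C : numClosedFieldType) (W S T : finType)
    (rho : op C (W * S * T)%type) : op C S :=
  mkop (fun x y => \sum_(w : W) \sum_(t : T) entry rho (w, x, t) (w, y, t)).

Inductive party := Alice | Bob.

Definition opponent (X : party) : party :=
  match X with Alice => Bob | Bob => Alice end.

Definition turn (first : party) (i : nat) : party :=
  if odd i then opponent first else first.

(* One player's side: the states com_state a that the player sends for the bit
   a, the round in which each of their qubits is sent, and the measurement (with
   its ancilla) by which the other player checks them.  The outcome Some a is
   the bit a, and None is "c", cheating detected. *)
Record commitment (C : numClosedFieldType) (n : nat) := Commitment {
  com_qubit : finType;
  com_round : com_qubit -> 'I_n;
  com_state : bool -> op C (qubits com_qubit);
  com_ancilla : finType;
  com_ancilla_state : op C com_ancilla;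
  com_check : option bool -> op C (qubits com_qubit * com_ancilla)%type;
  com_state_density : forall a, density (com_state a);
  com_state_orthogonal :
    orthogonal_supports (com_state false) (com_state true);
  com_ancilla_density : density com_ancilla_state;
  com_check_projective : projective_measurement com_check;
  com_check_certain : forall a,
    \tr (com_check (Some a) *m tens (com_state a) com_ancilla_state) = 1
}.

Record protocol (C : numClosedFieldType) := Protocol {
  rounds : nat;
  first : party;
  side : party -> commitment C rounds;
  side_turn : forall X (q : com_qubit (side X)),
    turn first (com_round q) = X
}.

(* What a dishonest X holds when round i begins, besides the workspace W:
   the qubits that X has still to send and those received in earlier rounds. *)
Definition unsent (C : numClosedFieldType) (P : protocol C) (X : party)
    (i : 'I_(rounds P)) : pred (com_qubit (side P X)) :=
  fun q => (i <= com_round q)%N.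

Definition received (C : numClosedFieldType) (P : protocol C) (X : party)
    (i : 'I_(rounds P)) : pred (com_qubit (side P (opponent X))) :=
  fun q => (com_round q < i)%N.

Definition lab (C : numClosedFieldType) (P : protocol C) (X : party)
    (W : finType) (i : 'I_(rounds P)) : finType :=
  (W * qubits {q | unsent (X := X) i q} * qubits {q | received (X := X) i q})%type.

(* A cheating strategy of X: a joint state of a private workspace and of the
   qubits X is to send, then, at the beginning of each round i, a quantum
   operation on everything X holds.  If round i is X's, the qubits of round i
   are sent after that operation. *)
Record strategy (C : numClosedFieldType) (P : protocol C) (X : party) :=
  Strategy {
  str_workspace : finType;
  str_prep : op C (str_workspace * qubits (com_qubit (side P X)))%type;
  str_kraus : forall i : 'I_(rounds P), seq (op C (lab X str_workspace i));
  str_prep_density : density str_prep;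
  str_kraus_family : forall i, kraus_family (str_kraus i)
}.

(* The joint state of X's workspace, X's qubits and the opponent's qubits at the
   end of the communication, when the honest opponent's bit is b. *)
Definition final_state (C : numClosedFieldType) (P : protocol C) (X : party)
    (s : strategy P X) (b : bool) :=
  foldl (fun rho i => kraus_apply [seq embed K | K <- str_kraus s i] rho)
    (tens (str_prep s) (com_state (side P (opponent X)) b))
    (enum 'I_(rounds P)).

(* Probability that the honest opponent, whose bit b is uniformly random, finds
   the bit v (+) b for X, hence the outcome (v (+) b) (+) b = v. *)
Definition outcome_prob (C : numClosedFieldType) (P : protocol C) (X : party)
    (s : strategy P X) (v : bool) : C :=
  2^-1 * \sum_(b : bool)
    \tr (com_check (side P X) (Some (v (+) b))
         *m tens (trace_out_ends (final_state s b))
                 (com_ancilla_state (side P X))).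

(* Main.v *)
Require Import Defs.
From mathcomp Require Import all_boot all_order all_algebra.
From mathcomp Require Import reals complex ring.
(* MathComp also exports a [restrict]; this makes the qubit restriction visible. *)
Import Defs.
Set Implicit Arguments.
Unset Strict Implicit.
Unset Printing Implicit Defensive.
Import Order.TTheory GRing.Theory Num.Theory.
Local Open Scope ring_scope.
Local Open Scope sesquilinear_scope.

(* For a player X and a round k, let F_X(k) be the overlap tr(sqrt s_0 sqrt s_1)
   of the reduced states s_0, s_1 on the qubits that X sends before round k for
   the bits 0 and 1.  At round k a dishonest X can
   - guess the bit of the opponent Y with success probability at least
     1 - F_Y(k) / 2, by the Powers-Stormer inequality;
   - open either bit with probability at least (1 + F_X(k)) / 2, by having sent
     its part of the normalized sum of the canonical purifications of s_0 and
     s_1 and then mapping the purifying system isometrically onto that of the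
     honest state.
   X guesses the bit of Y and then opens the bit it needs; the two successes are
   independent, so this wins with probability at least
   (1 - F_Y(k) / 2) (1 + F_X(k)) / 2, which is 9/16 when F_Y(k) <= 1/2 <= F_X(k).
   Both overlaps go from 1 to 0, and only one of them changes in a round,
   so the first round at which one of them is at most 1/2 is such a k. *)

(** * Positive matrices *)

Section Adjoint.
Variable C : numClosedFieldType.

Lemma adjmxM m n p (A : 'M[C]_(m, n)) (B : 'M[C]_(n, p)) :
  (A *m B)^t* = B^t* *m A^t*.
Proof. by rewrite trmx_mul map_mxM. Qed.

Lemma adjmxD m n (A B : 'M[C]_(m, n)) : (A + B)^t* = A^t* + B^t*.
Proof. by rewrite linearD /= map_mxD. Qed.

Lemma adjmxB m n (A B : 'M[C]_(m, n)) : (A - B)^t* = A^t* - B^t*.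
Proof. by rewrite linearB /= map_mxB. Qed.

Lemma adjmxZ m n c (A : 'M[C]_(m, n)) : (c *: A)^t* = c^* *: A^t*.
Proof. by rewrite linearZ /= map_mxZ. Qed.

Lemma adjmx1 n : (1%:M : 'M[C]_n)^t* = 1%:M.
Proof. by rewrite trmx1 map_mx1. Qed.

Lemma adjmxE m n (A : 'M[C]_(m, n)) i j : A^t* i j = (A j i)^*.
Proof. by rewrite !mxE. Qed.

Lemma trace_adjmx n (A : 'M[C]_n) : \tr (A^t*) = (\tr A)^*.
Proof. by rewrite rmorph_sum; apply: eq_bigr => i _; rewrite adjmxE. Qed.

Lemma trace_gramE m n (X : 'M[C]_(m, n)) :
  \tr (X^t* *m X) = \sum_j \sum_i `|X i j| ^+ 2.
Proof.
apply: eq_bigr => j _; rewrite mxE; apply: eq_bigr => i _.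
by rewrite adjmxE normCKC.
Qed.

Lemma trace_gram_ge0 m n (X : 'M[C]_(m, n)) : 0 <= \tr (X^t* *m X).
Proof.
by rewrite trace_gramE; do 2![apply: sumr_ge0 => ? _]; rewrite exprn_ge0.
Qed.

Lemma trace_gram_eq0 m n (X : 'M[C]_(m, n)) : \tr (X^t* *m X) = 0 -> X = 0.
Proof.
have ge0 i j : 0 <= `|X i j| ^+ 2 by rewrite exprn_ge0.
rewrite trace_gramE => /psumr_eq0P X0; apply/matrixP => i j; rewrite mxE.
have /psumr_eq0P/(_ i isT)/eqP :=
  X0 (fun j _ => sumr_ge0 _ (fun i _ => ge0 i j)) j isT.
by rewrite expf_eq0 normr_eq0 /= => /(_ (fun i _ => ge0 i j))/eqP.
Qed.

(** Expand the nonnegative Gram trace of [B - t *: A], where [t] is the coefficient of [B] along the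
    unit vector [A]. *)
Lemma trace_cauchy m n (A B : 'M[C]_(m, n)) : \tr (A^t* *m A) = 1 ->
  `|\tr (A^t* *m B)| ^+ 2 <= \tr (B^t* *m B).
Proof.
move=> A1; set t := \tr (A^t* *m B).
have tC : \tr (B^t* *m A) = t^* by rewrite -trace_adjmx adjmxM trmxCK.
have := trace_gram_ge0 (B - t *: A).
rewrite adjmxB adjmxZ mulmxBr !mulmxBl -!scalemxAl -!scalemxAr.
rewrite !linearB /= !linearZ /= A1 tC -/t.
by rewrite mulr1 [t^* * t]mulrC subrr subr0 -normCK subr_ge0.
Qed.

Definition posmx n (A : 'M[C]_n) : Prop :=
  forall v : 'cV[C]_n, 0 <= (v^t* *m A *m v) 0 0.

Lemma gram_posmx m n (X : 'M[C]_(m, n)) : posmx (X^t* *m X).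
Proof.
move=> v; have := trace_gram_ge0 (X *m v).
by rewrite adjmxM /mxtrace big_ord1 !mulmxA.
Qed.

Lemma posmx_adj n (A : 'M[C]_n) : posmx A -> A^t* = A.
Proof.
move=> Apos; apply/matrixP => i j; rewrite adjmxE.
(* [q c] is the quadratic form at [e_i + c e_j]. Its being real at [c = 1] and at [c = 'i] forces
   [A i j] and [A j i] to be conjugate. *)
pose q c := A i i + c^* * c * A j j + c * A i j + c^* * A j i.
have qreal c : (q c)^* = q c.
  apply/CrealP/ger0_real.
  pose v : 'cV[C]_n := delta_mx i 0 + c *: delta_mx j 0.
  suff -> : q c = (v^t* *m A *m v) 0 0 by [].
  rewrite adjmxD adjmxZ !trmx_delta !map_delta_mx.
  rewrite mulmxDr !mulmxDl -!scalemxAr -!scalemxAl -!rowE -!colE !mxE.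
  rewrite /q; ring.
have diagreal k : (A k k)^* = A k k.
  apply/CrealP/ger0_real; have := Apos (delta_mx k 0).
  by rewrite trmx_delta map_delta_mx -rowE -colE !mxE.
have := qreal 1; have := qreal 'i; rewrite /q !rmorphD !rmorphM /= !diagreal.
rewrite !conjCK conjCi !rmorph1 !mul1r.
set a := A i j; set b := A j i => qi q1.
have {}qi : 'i * (b^* - a^*) = 'i * (a - b) :> C.
  apply: (addrI (A i i + - 'i * 'i * A j j)).
  by transitivity (A i i + - 'i * 'i * A j j + 'i * a + - 'i * b);
    [rewrite -qi|]; ring.
have ba : b^* - a^* = a - b by apply: (mulfI (neq0Ci C)).
apply: (mulfI (_ : 2%:R != 0 :> C)); first by rewrite pnatr_eq0.
transitivity (a + b + (a - b)); last by ring.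
rewrite -ba; transitivity (a^* + b^* + (b^* - a^*)); first by ring.
congr (_ + _); apply: (addrI (A i i + A j j)); rewrite !addrA.
exact: q1.
Qed.
End Adjoint.

(** * Spectral calculus *)

Section SpectralCalculus.
Variable C : numClosedFieldType.

(** Functional calculus in the eigenbasis. The algebraic laws below hold for every [A], since
    [spectralmx A] is always unitary; Hermiticity enters only in [fmx_id]. *)
Definition fmx (f : C -> C) n (A : 'M[C]_n) : 'M[C]_n :=
  (spectralmx A)^t* *m diag_mx (map_mx f (spectral_diag A)) *m spectralmx A.

Lemma spectral_adjmxK n (A : 'M[C]_n) : (spectralmx A)^t* *m spectralmx A = 1%:M.
Proof.
rewrite -(invmx_unitary (spectral_unitarymx A)).
by rewrite mulVmx // spectral_unit.
Qed.

Lemma spectral_mulmxK n (A : 'M[C]_n) : spectralmx A *m (spectralmx A)^t* = 1%:M.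
Proof. exact/unitarymxP/spectral_unitarymx. Qed.

Lemma fmxM f g n (A : 'M[C]_n) :
  fmx f A *m fmx g A = fmx (fun x => f x * g x) A.
Proof.
rewrite /fmx !mulmxA -[_ *m spectralmx A *m _]mulmxA spectral_mulmxK mulmx1.
rewrite -[_ *m diag_mx _ *m diag_mx _]mulmxA mulmx_diag.
by congr (_ *m diag_mx _ *m _); apply/rowP => i; rewrite !mxE.
Qed.

Lemma fmxB f g n (A : 'M[C]_n) :
  fmx f A - fmx g A = fmx (fun x => f x - g x) A.
Proof.
rewrite /fmx -mulmxBl -mulmxBr -linearB /=.
by congr (_ *m diag_mx _ *m _); apply/rowP => i; rewrite !mxE.
Qed.

Lemma fmx1 n (A : 'M[C]_n) : fmx (fun=> 1) A = 1%:M.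
Proof.
rewrite /fmx (_ : map_mx _ (spectral_diag A) = const_mx 1); last first.
  by apply/rowP => i; rewrite !mxE.
by rewrite diag_const_mx mulmx1 spectral_adjmxK.
Qed.

Lemma fmx_adj f n (A : 'M[C]_n) : (fmx f A)^t* = fmx (fun x => (f x)^*) A.
Proof.
rewrite /fmx !adjmxM trmxCK mulmxA; congr (_ *m _ *m _).
by rewrite tr_diag_mx map_diag_mx; congr diag_mx; apply/rowP => i; rewrite !mxE.
Qed.

Lemma eq_fmx f g n (A : 'M[C]_n) :
  (forall i, f (spectral_diag A 0 i) = g (spectral_diag A 0 i)) ->
  fmx f A = fmx g A.
Proof.
by move=> fg; congr (_ *m diag_mx _ *m _); apply/rowP => i; rewrite !mxE fg.
Qed.

Lemma fmx_id n (A : 'M[C]_n) : A^t* = A -> fmx id A = A.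
Proof.
move=> Aadj; have Anormal : A \is normalmx by apply/normalmxP; rewrite Aadj.
rewrite /fmx (_ : map_mx id _ = spectral_diag A); last exact: map_mx_id.
rewrite -(invmx_unitary (spectral_unitarymx A)).
by rewrite -(orthomx_spectralP Anormal).
Qed.

Lemma fmx_diag f n (A : 'M[C]_n) :
  spectralmx A *m fmx f A *m (spectralmx A)^t* =
  diag_mx (map_mx f (spectral_diag A)).
Proof.
by rewrite /fmx !mulmxA spectral_mulmxK mul1mx -mulmxA spectral_mulmxK mulmx1.
Qed.

Lemma posmx_spectral_ge0 n (A : 'M[C]_n) :
  posmx A -> forall i, 0 <= spectral_diag A 0 i.
Proof.
move=> Apos i; have := Apos (col i ((spectralmx A)^t*)).
have := congr1 (fun M : 'M_n => M i i) (fmx_diag id A).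
rewrite (fmx_id (posmx_adj Apos)) [RHS]mxE eqxx mulr1n [RHS]mxE => <-.
rewrite tr_col map_row trmxCK -row_mul !mxE.
by under eq_bigr do rewrite !mxE; under [X in _ -> _ <= X]eq_bigr do rewrite !mxE.
Qed.

Lemma fmx_posmx f n (A : 'M[C]_n) :
  (forall i, 0 <= f (spectral_diag A 0 i)) -> posmx (fmx f A).
Proof.
move=> f0; pose g x := sqrtC (f x).
have -> : fmx f A = (fmx g A)^t* *m fmx g A.
  rewrite fmx_adj fmxM; apply: eq_fmx => i.
  by rewrite /g -normCKC ger0_norm ?sqrtC_ge0 // sqrtCK.
exact: gram_posmx.
Qed.

Definition sqrtmx n (A : 'M[C]_n) : 'M[C]_n := fmx sqrtC A.

Lemma sqrtmx_posmx n (A : 'M[C]_n) : posmx A -> posmx (sqrtmx A).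
Proof.
move=> Apos; apply: fmx_posmx => i.
by rewrite sqrtC_ge0 posmx_spectral_ge0.
Qed.

Lemma sqrtmx_adj n (A : 'M[C]_n) : posmx A -> (sqrtmx A)^t* = sqrtmx A.
Proof. by move=> Apos; exact/posmx_adj/sqrtmx_posmx. Qed.

Lemma sqrtmxK n (A : 'M[C]_n) : posmx A -> sqrtmx A *m sqrtmx A = A.
Proof.
move=> Apos; rewrite -[RHS](fmx_id (posmx_adj Apos)) fmxM.
by apply: eq_fmx => i; rewrite -expr2 sqrtCK.
Qed.

(** By cyclicity the trace is the Gram trace of [sqrtmx A *m sqrtmx B]. *)
Lemma trace_posmxM_ge0 n (A B : 'M[C]_n) :
  posmx A -> posmx B -> 0 <= \tr (A *m B).
Proof.
move=> Apos Bpos; rewrite -(sqrtmxK Apos) -(sqrtmxK Bpos) mulmxA mxtrace_mulC.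
have := trace_gram_ge0 (sqrtmx A *m sqrtmx B).
by rewrite adjmxM !sqrtmx_adj // !mulmxA.
Qed.

(* The witness projects onto the nonnegative eigenspaces of sqrt A - sqrt B. *)
Lemma powers_stormer n (A B : 'M[C]_n) :
  posmx A -> posmx B -> \tr A = 1 -> \tr B = 1 ->
  exists Q : 'M[C]_n, [/\ Q^t* = Q, Q *m Q = Q
    & 2%:R - \tr (sqrtmx A *m sqrtmx B)
      <= \tr (Q *m A) + \tr ((1%:M - Q) *m B)].
Proof.
move=> Apos Bpos A1 B1.
set a := sqrtmx A; set b := sqrtmx B; pose T := a - b.
have Tadj : T^t* = T by rewrite adjmxB !sqrtmx_adj.
pose q (x : C) : C := if 0 <= x then 1 else 0.
have dreal i : spectral_diag T 0 i \is Num.real.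
  apply/mxOverP/hermitian_spectral_diag_real.
  by apply/is_hermitianmxP; rewrite expr0 scale1r Tadj.
pose Q := fmx q T.
have QT : Q *m T = T *m Q.
  rewrite -(fmx_id Tadj) !fmxM; apply: eq_fmx => i.
  exact: mulrC.
(* [Q *m T] and [(Q - 1%:M) *m T] are the positive and negative parts of [T]. *)
have Tp : posmx (Q *m T).
  rewrite -(fmx_id Tadj) fmxM; apply: fmx_posmx => i.
  by rewrite /q; case: ifP; rewrite ?mul1r ?mul0r.
have Tn : posmx ((Q - 1%:M) *m T).
  rewrite -(fmx_id Tadj) -(fmx1 T) fmxB fmxM; apply: fmx_posmx => i /=.
  rewrite /q; case: (real_leP (real0 C) (dreal i)) => [_|lt0].
    by rewrite subrr mul0r.
  by rewrite sub0r mulN1r oppr_ge0 ltW.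
exists Q; split.
- rewrite fmx_adj; apply: eq_fmx => i.
  by rewrite /q; case: ifP; rewrite ?rmorph1 ?rmorph0.
- rewrite fmxM; apply: eq_fmx => i.
  by rewrite /q; case: ifP; rewrite ?mulr1 ?mul0r.
have aa : a *m a = A by exact: sqrtmxK.
have bb : b *m b = B by exact: sqrtmxK.
have apos : posmx a by exact: sqrtmx_posmx.
have bpos : posmx b by exact: sqrtmx_posmx.
(* The sum of these two nonnegative traces is the difference of the two sides of the goal: the terms
   [\tr (Q *m (a *m b))] cancel. *)
have := trace_posmxM_ge0 bpos Tp; have := trace_posmxM_ge0 apos Tn.
have -> : \tr (b *m (Q *m T)) = \tr (Q *m (a *m b)) - \tr (Q *m B).
  by rewrite mxtrace_mulC -mulmxA mulmxBl mulmxBr linearB /= bb.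
have -> : \tr (a *m ((Q - 1%:M) *m T)) =
    \tr (Q *m A) - \tr (Q *m (a *m b)) - (1 - \tr (a *m b)).
  rewrite mulmxBl mul1mx QT mulmxBr linearB /= [a *m (T *m Q)]mulmxA mxtrace_mulC.
  by rewrite /T !mulmxBr aa !linearB /= A1.
move=> h2 h1; rewrite mulmxBl mul1mx linearB /= B1 -subr_ge0.
by have := addr_ge0 h1 h2; congr (_ <= _); ring.
Qed.

End SpectralCalculus.

(** * Polar decomposition and opening *)

Section Opening.
Variable C : numClosedFieldType.

Definition overlap n (A : bool -> 'M[C]_n) : C :=
  \tr (sqrtmx (A false) *m sqrtmx (A true)).

Lemma overlap_ge0 n (A : bool -> 'M[C]_n) :
  (forall a, posmx (A a)) -> 0 <= overlap A.
Proof. by move=> Apos; apply: trace_posmxM_ge0; apply: sqrtmx_posmx. Qed.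

Lemma polar m n (X : 'M[C]_(m, n)) :
  exists V : 'M[C]_(m, n), X^t* *m V = sqrtmx (X^t* *m X)
    /\ V^t* *m V *m (V^t* *m V) = V^t* *m V.
Proof.
set A := X^t* *m X; have Apos : posmx A by exact: gram_posmx.
have Ad0 := posmx_spectral_ge0 Apos; have Aid := fmx_id (posmx_adj Apos).
(* As [0^-1 = 0], the second factor is the pseudo-inverse of the root of [A]. So [V] is only a
   partial isometry, and [V^t* *m V] projects onto the range of [A]. *)
pose V := X *m fmx (fun x => (sqrtC x)^-1) A.
exists V.
have -> : V^t* *m V = fmx (fun x => if x == 0 then 0 else 1) A.
  rewrite adjmxM fmx_adj mulmxA -[_ *m _ *m X]mulmxA -/A -{2}Aid !fmxM.
  apply: eq_fmx => i /=; set x := spectral_diag A 0 i.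
  case: eqP => [->|/eqP x0]; first by rewrite mulr0 mul0r.
  rewrite geC0_conj ?invr_ge0 ?sqrtC_ge0 ?Ad0 //.
  have := sqrtCK x; have := x0; rewrite -sqrtC_eq0.
  by move: (sqrtC x) => s s0 <-; field.
split; last by rewrite fmxM; apply: eq_fmx => i; case: ifP; rewrite ?mul0r ?mul1r.
rewrite mulmxA -/A -{1}Aid fmxM; apply: eq_fmx => i /=.
set x := spectral_diag A 0 i.
have [->|x0] := eqVneq x 0; first by rewrite sqrtC0 mul0r.
have := sqrtCK x; have := x0; rewrite -sqrtC_eq0.
by move: (sqrtC x) => s s0 <-; field.
Qed.

(** [X a] purifies a reduced state: columns index the sent system, rows the held one, and [J] embeds
    the canonical purifying system in the held one. [K a] undoes [J] and applies the polar factor of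
    [X a], which carries the root [H a] to [X a]. Both bits then have amplitude [(1 + F) / c], with
    [c] the norm of [H false + H true]. *)
Lemma opening m n (X : bool -> 'M[C]_(m, n)) (J : 'M[C]_(m, n)) :
  (forall a, \tr ((X a)^t* *m X a) = 1) -> J^t* *m J = 1%:M ->
  exists (Phi : 'M[C]_(m, n)) (K L : bool -> 'M[C]_m),
    [/\ \tr (Phi^t* *m Phi) = 1,
        forall a, (K a)^t* *m K a + (L a)^t* *m L a = 1%:M
      & forall a, `|\tr ((X a)^t* *m (K a *m Phi))| ^+ 2
                  = (1 + overlap (fun a => (X a)^t* *m X a)) / 2%:R].
Proof.
move=> X1 JJ; set F := overlap _.
pose H a := sqrtmx ((X a)^t* *m X a).
have Hpos a : posmx (H a) by exact/sqrtmx_posmx/gram_posmx.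
have Hadj a : (H a)^t* = H a by exact: posmx_adj.
have HH a : \tr (H a *m H a) = 1 by rewrite sqrtmxK //; exact: gram_posmx.
have HF a : \tr (H a *m (H false + H true)) = 1 + F.
  rewrite mulmxDr linearD /=.
  by case: a; rewrite HH // addrC mxtrace_mulC.
have F0 : 0 <= F by apply: overlap_ge0 => a; exact: gram_posmx.
have c20 : 0 < 2%:R * (1 + F) by rewrite mulr_gt0 ?ltr0n // ltr_wpDr.
pose c := sqrtC (2%:R * (1 + F)).
have c0 : 0 < c by rewrite sqrtC_gt0.
have cN : c != 0 by rewrite gt_eqF.
have cc : c^-1 * c^-1 = (2%:R * (1 + F))^-1.
  by rewrite -invfM -expr2 sqrtCK.
have /(_ _)/boolp.cid-/all_tag[V VP] := fun a => polar (X a).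
(* [K a] is a partial isometry, so [L a] is a projector and completes [K a] to a Kraus family. *)
pose K a := V a *m J^t*; pose L a := 1%:M - (K a)^t* *m K a.
exists (c^-1 *: (J *m (H false + H true))), K, L; split.
- rewrite adjmxZ -scalemxAl -scalemxAr !linearZ /= adjmxM.
  rewrite -mulmxA (mulmxA (J^t*)) JJ mul1mx adjmxD !Hadj mulmxDl linearD /= !HF.
  rewrite geC0_conj ?invr_ge0 1?ltW // mulrA cc.
  by rewrite -mulr2n -(mulr_natl (1 + F)) mulVf // gt_eqF.
- move=> a; set D := (K a)^t* *m K a.
  have Dadj : D^t* = D by rewrite adjmxM trmxCK.
  have DD : D *m D = D.
    have [_] := VP a.
    have -> : D = J *m ((V a)^t* *m V a) *m J^t*.
      by rewrite /D /K adjmxM trmxCK !mulmxA.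
    move: (_ *m V a) => G GG.
    by rewrite -!mulmxA (mulmxA (J^t*) J) JJ mul1mx (mulmxA G G) GG.
  rewrite adjmxB adjmx1 Dadj mulmxBl mulmxBr mulmx1 mul1mx mulmxBr DD mulmx1.
  by rewrite subrr subr0 addrC subrK.
move=> a; have XV : (X a)^t* *m V a = H a by case: (VP a).
rewrite -!scalemxAr linearZ /= /K !mulmxA -[_ *m J^t* *m J]mulmxA JJ mulmx1.
rewrite XV HF.
rewrite normrM exprMn !ger0_norm ?invr_ge0 1?ltW // ?ltr_wpDr //.
rewrite [_^-1 ^+ 2]expr2 cc.
have /gt_eqF/negbT FN : 0 < 1 + F by rewrite ltr_wpDr.
by field.
Qed.
End Opening.

(** * Operators on finite tensor products *)

Section Entries.
Variable C : numClosedFieldType.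

Definition ent (S T : finType) (A : 'M[C]_(#|S|, #|T|)) (x : S) (y : T) : C :=
  A (enum_rank x) (enum_rank y).

Definition mkmx (S T : finType) (f : S -> T -> C) : 'M[C]_(#|S|, #|T|) :=
  \matrix_(i, j) f (enum_val i) (enum_val j).

Lemma entryE (T : finType) : @entry C T = @ent T T.
Proof. by []. Qed.

Lemma mkmxE (S T : finType) (f : S -> T -> C) x y : ent (mkmx f) x y = f x y.
Proof. by rewrite /ent mxE !enum_rankK. Qed.

Lemma ent_mkop (T : finType) (f : T -> T -> C) x y : ent (mkop f) x y = f x y.
Proof. exact: mkopE. Qed.

Lemma ent_ext (S T : finType) (A B : 'M[C]_(#|S|, #|T|)) :
  (forall x y, ent A x y = ent B x y) -> A = B.
Proof.
move=> AB; apply/matrixP => i j.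
by have := AB (enum_val i) (enum_val j); rewrite /ent !enum_valK.
Qed.

Lemma big_ord_card (T : finType) (F : 'I_#|T| -> C) :
  \sum_i F i = \sum_(x : T) F (enum_rank x).
Proof. by rewrite (reindex _ (onW_bij _ (@enum_rank_bij T))). Qed.

Lemma ent_mul (S T U : finType) (A : 'M[C]_(#|S|, #|T|))
    (B : 'M[C]_(#|T|, #|U|)) x y :
  ent (A *m B) x y = \sum_z ent A x z * ent B z y.
Proof. by rewrite /ent mxE big_ord_card. Qed.

Lemma ent_adj (S T : finType) (A : 'M[C]_(#|S|, #|T|)) x y :
  ent (A^t*) x y = (ent A y x)^*.
Proof. by rewrite /ent !mxE. Qed.

Lemma ent1 (T : finType) x y : ent (1%:M : 'M[C]_#|T|) x y = (x == y)%:R.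
Proof. by rewrite /ent mxE (inj_eq enum_rank_inj). Qed.

Lemma ent0 (S T : finType) x y : ent (0 : 'M[C]_(#|S|, #|T|)) x y = 0.
Proof. by rewrite /ent mxE. Qed.

Lemma mxtraceE (T : finType) (A : 'M[C]_#|T|) : \tr A = \sum_x ent A x x.
Proof. exact: big_ord_card. Qed.

Lemma entD (S T : finType) (A B : 'M[C]_(#|S|, #|T|)) x y :
  ent (A + B) x y = ent A x y + ent B x y.
Proof. by rewrite /ent mxE. Qed.

Lemma entZ (S T : finType) c (A : 'M[C]_(#|S|, #|T|)) x y :
  ent (c *: A) x y = c * ent A x y.
Proof. by rewrite /ent mxE. Qed.

Definition entE := (entryE, mkmxE, ent_mkop, ent_mul, ent_adj, ent1, entD, entZ).

Lemma tens_mul (S T : finType) (A A' : op C S) (B B' : op C T) :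
  tens A B *m tens A' B' = tens (A *m A') (B *m B').
Proof.
apply: ent_ext => x y; rewrite !entE big_distrlr /= pair_bigA /=.
by apply: eq_bigr => z _; rewrite !entE mulrACA.
Qed.

Lemma tens_adj (S T : finType) (A : op C S) (B : op C T) :
  (tens A B)^t* = tens (A^t*) (B^t*).
Proof. by apply: ent_ext => x y; rewrite !entE rmorphM. Qed.

Lemma tens1 (S T : finType) : tens (1%:M : op C S) (1%:M : op C T) = 1%:M.
Proof.
apply: ent_ext => -[x x'] [y y']; rewrite !entE /= -natrM mulnb.
by rewrite xpair_eqE.
Qed.

Lemma tensDl (S T : finType) (A A' : op C S) (B : op C T) :
  tens (A + A') B = tens A B + tens A' B.
Proof. by apply: ent_ext => x y; rewrite !entE mulrDl. Qed.

Lemma tensDr (S T : finType) (A : op C S) (B B' : op C T) :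
  tens A (B + B') = tens A B + tens A B'.
Proof. by apply: ent_ext => x y; rewrite !entE mulrDr. Qed.

Lemma tensZl (S T : finType) c (A : op C S) (B : op C T) :
  tens (c *: A) B = c *: tens A B.
Proof. by apply: ent_ext => x y; rewrite !entE mulrA. Qed.

Lemma mxtrace_tens (S T : finType) (A : op C S) (B : op C T) :
  \tr (tens A B) = \tr A * \tr B.
Proof.
rewrite !mxtraceE big_distrlr /= pair_bigA /=.
by apply: eq_bigr => z _; rewrite !entE.
Qed.

End Entries.

(** * Local operators, partial traces and purifications for a factored basis *)

Section Regroup.
Variables (C : numClosedFieldType) (X A B : finType).
Variables (f : X -> A) (g : X -> B) (j : A -> B -> X).
Hypotheses (fK : forall a b, f (j a b) = a) (gK : forall a b, g (j a b) = b).
Hypothesis jK : forall x, j (f x) (g x) = x.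

Lemma sum_regroup (F : X -> C) : \sum_x F x = \sum_a \sum_b F (j a b).
Proof.
rewrite pair_bigA /= (reindex (fun p : A * B => j p.1 p.2)) //=.
exists (fun x => (f x, g x)) => [[a b] _|x _] /=; last exact: jK.
by rewrite fK gK.
Qed.

(* K (x) 1_B, read through the bijection (f, g) between X and A * B. *)
Definition ampliate (K : op C A) : op C X :=
  mkop (fun x y => if g x == g y then entry K (f x) (f y) else 0).

Lemma ampliate_mul (K L : op C A) :
  ampliate K *m ampliate L = ampliate (K *m L).
Proof.
apply: ent_ext => x y; rewrite !entE sum_regroup.
under eq_bigr => a _ do under eq_bigr => b _ do rewrite !entE !fK !gK.
rewrite exchange_big /= (bigD1 (g y)) //= [X in _ + X]big1 ?addr0; last first.
  move=> b /negPf ne.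
  by apply: big1 => a _; rewrite ne mulr0.
rewrite eqxx; case: eqP => _; last by apply: big1 => a _; rewrite mul0r.
by [].
Qed.

Lemma ampliate_adj (K : op C A) : (ampliate K)^t* = ampliate (K^t*).
Proof.
apply: ent_ext => x y; rewrite !entE eq_sym.
by case: eqP => _; rewrite ?rmorph0 ?entE.
Qed.

(* The transpose of the partial trace over B. *)
Definition coreduced (rho : op C X) : op C A :=
  mkop (fun a a' => \sum_b entry rho (j a' b) (j a b)).

Lemma trace_ampliate (K : op C A) (rho : op C X) :
  \tr (ampliate K^T *m rho) = \tr (K *m coreduced rho).
Proof.
rewrite !mxtraceE sum_regroup.
under [RHS]eq_bigr do rewrite ent_mul; rewrite [RHS]exchange_big /=.
apply: eq_bigr => a _; under eq_bigr do rewrite ent_mul sum_regroup.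
rewrite exchange_big /=; apply: eq_bigr => a' _; rewrite entE big_distrr /=.
apply: eq_bigr => b _; rewrite (bigD1 b) //= big1 ?addr0 => [|b' /negPf ne].
  by rewrite !entE !fK !gK eqxx /ent mxE.
by rewrite !entE !gK eq_sym ne mul0r.
Qed.

Lemma coreduced_trace (rho : op C X) : \tr (coreduced rho) = \tr rho.
Proof.
rewrite !mxtraceE sum_regroup; apply: eq_bigr => a _.
by rewrite entE entryE.
Qed.

(* The purification sum_w (r w) (x) w of r r^*, as a matrix whose columns are
   indexed by A and whose rows by the purifying system together with B. *)
Definition split_purification (r : op C X) : 'M[C]_(#|{: X * B}|, #|A|) :=
  mkmx (fun (p : X * B) a => ent r (j a p.2) p.1).

(** This identity accounts for the transpose in [coreduced]: in a Gram matrix the row index comes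
    from the conjugated factor. *)
Lemma coreduced_gram (r : op C X) :
  (split_purification r)^t* *m split_purification r = coreduced (r *m r^t*).
Proof.
apply: ent_ext => a a'; rewrite !entE.
under [RHS]eq_bigr do rewrite !entE.
rewrite exchange_big pair_bigA /=; apply: eq_bigr => -[x b] _.
by rewrite !entE mulrC.
Qed.

Lemma coreduced_posmx (rho : op C X) : posmx rho -> posmx (coreduced rho).
Proof.
move=> rpos; rewrite -(sqrtmxK rpos) -{2}(sqrtmx_adj rpos) -coreduced_gram.
exact: gram_posmx.
Qed.

(** A matrix read as a pure state of the pair; [unit] makes it a single column. *)
Definition vectorize (Phi : 'M[C]_(#|A|, #|B|)) : 'M[C]_(#|X|, #|{: unit}|) :=
  mkmx (fun x _ => ent Phi (f x) (g x)).

Lemma ampliate_vectorize (K : op C A) Phi :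
  ampliate K *m vectorize Phi = vectorize (K *m Phi).
Proof.
apply: ent_ext => x u; rewrite !entE sum_regroup; apply: eq_bigr => a _.
rewrite (bigD1 (g x)) //= big1 ?addr0 => [|b /negPf ne].
  by rewrite !entE fK !gK eqxx.
by rewrite !entE gK eq_sym ne mul0r.
Qed.

Lemma trace_vectorize Phi :
  \tr (vectorize Phi *m (vectorize Phi)^t*) = \tr (Phi^t* *m Phi).
Proof.
rewrite mxtrace_mulC !mxtraceE [LHS](bigD1 tt) //=.
rewrite [X in _ + X]big1 ?addr0; last by case.
rewrite ent_mul sum_regroup exchange_big /=; apply: eq_bigr => b _.
by rewrite ent_mul; apply: eq_bigr => a _; rewrite !entE fK gK.
Qed.

(** The regrouping of [split_purification] undone: [A] and [B] merge into the row index and the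
    purifying index becomes the column, so that [z *m z^t*] traces it out. *)
Definition fuse (Psi : 'M[C]_(#|{: X * B}|, #|A|)) : op C X :=
  mkop (fun x w => ent Psi (w, g x) (f x)).

Lemma trace_fuse (r : op C X) Psi :
  \tr (r^t* *m fuse Psi) = \tr ((split_purification r)^t* *m Psi).
Proof.
rewrite !mxtraceE; under eq_bigr do rewrite ent_mul sum_regroup.
rewrite exchange_big /=; apply: eq_bigr => a _.
rewrite ent_mul pair_bigA /=; apply: eq_bigr => -[w b] _.
by rewrite !entE fK gK.
Qed.
End Regroup.

(** * Splitting a register of qubits *)

Section Join.
Variables (Q : finType) (p : pred Q).

(** The final [false] is never reached, since each qubit satisfies [p] or its negation. *)
Definition join (s : qubits {q | p q}) (u : qubits {q | ~~ p q}) : qubits Q :=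
  [ffun q => if insub q is Some i then s i
             else if insub q is Some i then u i else false].

Lemma join_restrict x : join (restrict p x) (restrict (fun q => ~~ p q) x) = x.
Proof.
apply/ffunP => q; rewrite ffunE; case: insubP => [i _ <-|np].
  by rewrite ffunE.
by rewrite insubT /= ffunE.
Qed.

Lemma restrict_joinl s u : restrict p (join s u) = s.
Proof. by apply/ffunP => i; rewrite !ffunE valK. Qed.

Lemma restrict_joinr s u : restrict (fun q => ~~ p q) (join s u) = u.
Proof.
by apply/ffunP => i; rewrite !ffunE insubN ?valK //; exact: (valP i).
Qed.

Lemma restrict_eqE x y :
  (restrict p x == restrict p y) = [forall q, p q ==> (x q == y q)].
Proof.
apply/eqP/forallP => [xy q|xy].
  apply/implyP => pq; have /ffunP/(_ (exist _ q pq)) := xy.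
  by rewrite !ffunE => ->.
by apply/ffunP => -[q pq]; rewrite !ffunE; apply/eqP/(implyP (xy q)).
Qed.
End Join.

Section Lab.
Variables (C : numClosedFieldType) (W S T : finType) (p : pred S) (r : pred T).
Let U := qubits {q | ~~ p q}.

Definition lab_kept (x : W * qubits S) : W * U :=
  (x.1, restrict (fun q => ~~ p q) x.2).
Definition lab_sent (x : W * qubits S) := restrict p x.2.
Definition lab_join (a : W * U) s : W * qubits S := (a.1, join s a.2).

Lemma lab_joinK x : lab_join (lab_kept x) (lab_sent x) = x.
Proof. by case: x => w x; rewrite /lab_join join_restrict. Qed.

Lemma lab_kept_join a s : lab_kept (lab_join a s) = a.
Proof. by case: a => w u; rewrite /lab_kept restrict_joinr. Qed.

Lemma lab_sent_join a s : lab_sent (lab_join a s) = s.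
Proof. exact: restrict_joinl. Qed.

(** A product Kraus operator stays a product across the two players' registers; this makes guessing
    and opening independent. *)
Lemma embed_tens (K : op C (W * U)%type) (E : op C (qubits {q | r q})) :
  embed (p := fun q => ~~ p q) (tens K E : op C (W * U * _)%type) =
  tens (ampliate lab_kept lab_sent K)
       (ampliate (restrict r) (restrict (fun q => ~~ r q)) E).
Proof.
apply: ent_ext => -[[w x] t] [[w' x'] t']; rewrite !entE /=.
rewrite /lab_sent /= !restrict_eqE.
under eq_forallb do rewrite negbK.
by case: [forall _, _]; case: [forall _, _]; rewrite ?mul0r ?mulr0.
Qed.

Lemma trace_out_endsD (A B : op C (W * S * T)%type) :
  trace_out_ends (A + B) = trace_out_ends A + trace_out_ends B.
Proof.
apply: ent_ext => x y; rewrite !entE -big_split; apply: eq_bigr => w _ /=.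
by rewrite -big_split; apply: eq_bigr => t _; rewrite /= entD.
Qed.

End Lab.

Lemma trace_out_vectorize (C : numClosedFieldType) (S T : finType) (p : pred S)
    (Psi : 'M[C]_(#|{: qubits S * qubits {q | ~~ p q}}|, #|qubits {q | p q}|))
    (tau : op C T) :
  let v := vectorize (@lab_kept (qubits S) S p) (@lab_sent (qubits S) S p) Psi in
  let z := fuse (restrict p) (restrict (fun q => ~~ p q)) Psi in
  trace_out_ends (tens (v *m v^t*) tau) = \tr tau *: (z *m z^t*).
Proof.
move=> v z; apply: ent_ext => x y; rewrite !entE mxtraceE big_distrr /=.
apply: eq_bigr => w _; rewrite mulrC big_distrr; apply: eq_bigr => t _ /=.
rewrite !entE (bigD1 tt) //= big1 ?addr0 => [|[] //].
by rewrite !entE.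
Qed.

(** * Probability of passing the honest check *)

Section Pass.
Variable C : numClosedFieldType.

(** A state accepted with certainty satisfies [M *m R = R], so the overlap of [R] with [Z] is that
    with [M *m Z], and Cauchy-Schwarz applies. *)
Lemma projector_overlap m n (M : 'M[C]_m) (R Z : 'M[C]_(m, n)) :
  M^t* = M -> M *m M = M ->
  \tr (R *m R^t*) = 1 -> \tr (M *m (R *m R^t*)) = 1 ->
  `|\tr (R^t* *m Z)| ^+ 2 <= \tr (M *m (Z *m Z^t*)).
Proof.
move=> Madj MM R1 MR1.
have trM N Y : N^t* = N -> N *m N = N ->
    \tr ((N *m Y)^t* *m (N *m Y)) = \tr (N *m (Y *m Y^t*)) :> C.
  move=> Nadj NN; rewrite adjmxM Nadj -mulmxA (mulmxA N) NN.
  by rewrite mxtrace_mulC mulmxA.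
have Mc : (1%:M - M)^t* = 1%:M - M by rewrite adjmxB adjmx1 Madj.
have McK : (1%:M - M) *m (1%:M - M) = 1%:M - M.
  by rewrite mulmxBl !mulmxBr !mulmx1 mul1mx MM subrr subr0.
have MR : M *m R = R.
  have /trace_gram_eq0 : \tr (((1%:M - M) *m R)^t* *m ((1%:M - M) *m R)) = 0.
    by rewrite trM // mulmxBl mul1mx linearB /= R1 MR1 subrr.
  by rewrite mulmxBl mul1mx => /eqP; rewrite subr_eq0 => /eqP.
have RM : R^t* *m M = R^t* by rewrite -{2}MR adjmxM Madj.
rewrite -(trM _ _ M Z) // -RM -mulmxA.
by apply: trace_cauchy; rewrite mxtrace_mulC.
Qed.

Variables (n : nat) (c : commitment C n).
Implicit Types rho z : op C (qubits (com_qubit c)).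

Definition pass_prob a rho : C :=
  \tr (com_check c (Some a) *m tens rho (com_ancilla_state c)).

Lemma pass_probD a rho rho' :
  pass_prob a (rho + rho') = pass_prob a rho + pass_prob a rho'.
Proof. by rewrite /pass_prob tensDl mulmxDr linearD. Qed.

Lemma pass_probZ a x rho : pass_prob a (x *: rho) = x * pass_prob a rho.
Proof. by rewrite /pass_prob tensZl -scalemxAr linearZ. Qed.

(** Tensoring with the root [s] of the ancilla state gives purifications that include the ancilla,
    and the overlap is unchanged because [s] has unit norm. *)
Lemma pass_prob_overlap a z :
  `|\tr ((sqrtmx (com_state c a))^t* *m z)| ^+ 2 <= pass_prob a (z *m z^t*).
Proof.
have [rpos r1] := com_state_density c a.
have [spos s1] := com_ancilla_density c.
have [Madj MM _] := com_check_projective c.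
set r := sqrtmx _; set s := sqrtmx (com_ancilla_state c).
have ss : s *m s^t* = com_ancilla_state c.
  by rewrite (sqrtmx_adj spos) (sqrtmxK spos).
have rr : r *m r^t* = com_state c a.
  by rewrite (sqrtmx_adj rpos) (sqrtmxK rpos).
have -> : \tr (r^t* *m z) = \tr ((tens r s)^t* *m tens z s).
  by rewrite tens_adj tens_mul mxtrace_tens [\tr (s^t* *m s)]mxtrace_mulC ss s1
    mulr1.
have -> : pass_prob a (z *m z^t*) =
    \tr (com_check c (Some a) *m (tens z s *m (tens z s)^t*)).
  by rewrite tens_adj tens_mul ss.
apply: projector_overlap => //; first by rewrite MM eqxx.
  by rewrite tens_adj tens_mul mxtrace_tens ss rr r1 s1 mulr1.
by rewrite tens_adj tens_mul ss rr com_check_certain.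
Qed.

Lemma pass_prob_ge0 a z : 0 <= pass_prob a (z *m z^t*).
Proof. by apply: le_trans (pass_prob_overlap a z); rewrite exprn_ge0. Qed.

End Pass.

(** * Cheating at a fixed round *)

Section Attack.
Variable C : numClosedFieldType.

Definition sent_state n (c : commitment C n) (p : pred (com_qubit c)) (a : bool) :=
  coreduced (@join _ p) (com_state c a).

Definition sent_overlap n (c : commitment C n) (p : pred (com_qubit c)) : C :=
  overlap (sent_state p).

Lemma sent_state_posmx n (c : commitment C n) (p : pred (com_qubit c)) a :
  posmx (sent_state p a).
Proof.
by apply: coreduced_posmx; case: (com_state_density c a).
Qed.

Lemma sent_state_trace n (c : commitment C n) (p : pred (com_qubit c)) a :
  \tr (sent_state p a) = 1.
Proof.
rewrite (coreduced_trace (@restrict_joinl _ p) (@restrict_joinr _ p)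
  (@join_restrict _ p)).
by case: (com_state_density c a).
Qed.

(** Half of the right-hand sum is the probability of guessing a uniform bit from the qubits in
    [p]. *)
Lemma sent_guess n (c : commitment C n) (p : pred (com_qubit c)) :
  exists E : bool -> op C (qubits {q | p q}),
  [/\ forall a, (E a)^t* *m E a = E a, E false + E true = 1%:M
    & 2%:R - sent_overlap p
      <= \sum_a \tr (ampliate (restrict p) (restrict (fun q => ~~ p q)) (E a)
                     *m com_state c a)].
Proof.
have [P [Padj PP Pge]] := powers_stormer (@sent_state_posmx _ c p false)
  (@sent_state_posmx _ c p true) (sent_state_trace p false)
  (sent_state_trace p true).
have PTP (N : 'M[C]_#|qubits {q | p q}|) : N^t* = N -> N *m N = N ->
    (N^T)^t* *m N^T = N^T.
  move=> Nadj NN; rewrite trmxK.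
  have -> : map_mx Num.conj N = N^T by rewrite -{2}Nadj map_trmx trmxK.
  by rewrite -trmx_mul NN.
(* The Powers-Stormer projector acts on transposed reduced states, so it is transposed back to act
   on the actual qubits. *)
exists (fun a => (if a then 1%:M - P else P)^T); split.
- case; apply: PTP => //; first by rewrite adjmxB adjmx1 Padj.
  by rewrite mulmxBl mul1mx mulmxBr mulmx1 PP subrr subr0.
- by rewrite -linearD /= addrC subrK trmx1.
rewrite big_bool [X in _ <= X]addrC.
rewrite !(trace_ampliate (@restrict_joinl _ p) (@restrict_joinr _ p)
  (@join_restrict _ p)).
exact: Pge.
Qed.

Definition held_state n (c : commitment C n) (p : pred (com_qubit c)) Psi :=
  let z := fuse (restrict p) (restrict (fun q => ~~ p q)) Psi in
  z *m z^t* : op C (qubits (com_qubit c)).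

Lemma held_state_pass_ge0 n (c : commitment C n) (p : pred (com_qubit c)) a Psi :
  0 <= pass_prob a (held_state (p := p) Psi).
Proof. exact: pass_prob_ge0. Qed.

Lemma sent_opening n (c : commitment C n) (p : pred (com_qubit c)) :
  let W := qubits (com_qubit c) in let U := qubits {q | ~~ p q} in
  exists (Phi : 'M[C]_(#|{: W * U}|, #|qubits {q | p q}|))
         (K L : bool -> op C (W * U)%type),
  [/\ \tr (Phi^t* *m Phi) = 1,
      forall a, (K a)^t* *m K a + (L a)^t* *m L a = 1%:M
    & forall a, (1 + sent_overlap p) / 2%:R
                <= pass_prob a (held_state (p := p) (K a *m Phi))].
Proof.
move=> W U.
pose u0 : U := [ffun => false].
pose J : 'M[C]_(#|{: W * U}|, #|qubits {q | p q}|) :=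
  mkmx (fun wu s => (wu == (join s u0, u0))%:R).
have JJ : J^t* *m J = 1%:M.
  apply: ent_ext => s s'; rewrite !entE (bigD1 (join s u0, u0)) //=.
  rewrite big1 ?addr0 => [|wu /negPf ne]; last by rewrite !entE ne rmorph0 mul0r.
  rewrite !entE eqxx rmorph1 mul1r; congr (nat_of_bool _)%:R.
  apply/eqP/eqP => [[]|->] // /(congr1 (restrict p)).
  by rewrite !restrict_joinl.
pose X a := split_purification (@join _ p) (sqrtmx (com_state c a)).
have XX a : (X a)^t* *m X a = sent_state p a.
  rewrite coreduced_gram; have [rpos _] := com_state_density c a.
  by rewrite (sqrtmx_adj rpos) (sqrtmxK rpos).
have X1 a : \tr ((X a)^t* *m X a) = 1 by rewrite XX sent_state_trace.
have [Phi [K [L [Phi1 KL ge]]]] := opening X1 JJ.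
exists Phi, K, L; split=> // a.
rewrite (_ : sent_overlap p = overlap (fun a => (X a)^t* *m X a)); last first.
  by rewrite /overlap !XX.
rewrite -(ge a) -(trace_fuse (@restrict_joinl _ p) (@restrict_joinr _ p)
  (@join_restrict _ p)).
exact: pass_prob_overlap.
Qed.

Lemma trace_sandwich_ge0 n (A rho : 'M[C]_n) :
  posmx rho -> 0 <= \tr (A *m rho *m A^t*).
Proof.
move=> rpos; rewrite -(sqrtmxK rpos) -{2}(sqrtmx_adj rpos) mulmxA -mulmxA -adjmxM.
by rewrite mxtrace_mulC trace_gram_ge0.
Qed.

(** The cheater measures the received qubits with [E] and opens its own commitment to the guessed
    bit, so a correct guess followed by a successful opening gives equal bits, hence outcome
    [false]. *)
Lemma attack n m (c : commitment C n) (d : commitment C m)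
    (p : pred (com_qubit c)) (r : pred (com_qubit d)) :
  let W := qubits (com_qubit c) in
  exists (prep : op C (W * qubits (com_qubit c))%type)
    (Ks : seq (op C (W * qubits {q | ~~ p q} * qubits {q | r q})%type)),
  [/\ density prep, kraus_family Ks
    & (2%:R - sent_overlap r) * ((1 + sent_overlap p) / 2%:R) <=
      \sum_b pass_prob b (trace_out_ends
        (kraus_apply [seq embed (p := fun q => ~~ p q) K | K <- Ks]
                     (tens prep (com_state d b))))].
Proof.
move=> W.
have [Phi [K [L [Phi1 KL pass]]]] := sent_opening p.
have [E [EE E1 guess]] := sent_guess r.
pose amp := @ampliate C _ _ _ (@lab_kept W _ p) (@lab_sent W _ p).
pose vec := @vectorize C _ _ _ (@lab_kept W _ p) (@lab_sent W _ p).
pose ampT := ampliate (restrict r) (restrict (fun q => ~~ r q)) : op C _ -> op C _.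
have ampTE a : (ampT (E a))^t* *m ampT (E a) = ampT (E a).
  rewrite ampliate_adj (ampliate_mul (@restrict_joinl _ r) (@restrict_joinr _ r)
    (@join_restrict _ r)).
  by rewrite EE.
have vecM A : amp A *m vec Phi = vec (A *m Phi).
  exact: (ampliate_vectorize (@lab_kept_join W _ p) (@lab_sent_join W _ p)
    (@lab_joinK W _ p)).
pose prep := vec Phi *m (vec Phi)^t*.
pose Ks := [:: tens (K false) (E false); tens (L false) (E false);
               tens (K true) (E true); tens (L true) (E true)].
exists prep, Ks; split.
- split; first by rewrite /prep -{1}(trmxCK (vec Phi)); exact: gram_posmx.
  by rewrite (trace_vectorize (@lab_kept_join W _ p) (@lab_sent_join W _ p)
    (@lab_joinK W _ p)).
- rewrite /kraus_family /Ks !big_cons big_nil addr0 !tens_adj !tens_mul addrA.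
  by rewrite -!tensDl !EE !KL -tensDr E1 tens1.
pose out b (A : op C (W * qubits {q | ~~ p q})%type) (B : op C (qubits {q | r q})) :=
  pass_prob (c := c) b (trace_out_ends
    (embed (p := fun q => ~~ p q) (tens A B) *m tens prep (com_state d b)
     *m (embed (p := fun q => ~~ p q) (tens A B))^t*)).
have outE b A B : out b A B =
    \tr (ampT B *m com_state d b *m (ampT B)^t*)
    * pass_prob (c := c) b (held_state (p := p) (A *m Phi)).
  rewrite /out embed_tens tens_adj !tens_mul.
  rewrite (_ : amp A *m prep *m (amp A)^t* = vec (A *m Phi) *m (vec (A *m Phi))^t*).
    by rewrite trace_out_vectorize pass_probZ.
  by rewrite -vecM /prep adjmxM !mulmxA.
have dpos b : posmx (com_state d b) by case: (com_state_density d b).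
have out_ge0 b A B : 0 <= out b A B.
  by rewrite outE mulr_ge0 ?held_state_pass_ge0 ?trace_sandwich_ge0.
have outKE b : \tr (ampT (E b) *m com_state d b) * ((1 + sent_overlap p) / 2%:R)
    <= out b (K b) (E b).
  rewrite outE [X in X * pass_prob _ _]mxtrace_mulC mulmxA ampTE.
  apply: ler_wpM2l; last exact: pass.
  by rewrite -ampTE -mulmxA mxtrace_mulC; apply: trace_sandwich_ge0.
have sumE b : pass_prob b (trace_out_ends
    (kraus_apply [seq embed (p := fun q => ~~ p q) K | K <- Ks]
                 (tens prep (com_state d b)))) =
    out b (K false) (E false) + out b (L false) (E false)
    + (out b (K true) (E true) + out b (L true) (E true)).
  rewrite /kraus_apply /Ks /= !big_cons big_nil addr0 [X in trace_out_ends X]addrA.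
  by rewrite !trace_out_endsD !pass_probD.
under eq_bigr do rewrite sumE; clearbody out.
(* Only the branches with a correct guess and the opening operator [K b] are counted; the others
   contribute nonnegative amounts. *)
apply: le_trans (_ : \sum_b out b (K b) (E b) <= _); last first.
  apply: ler_sum => -[] _; last by rewrite -addrA lerDl !addr_ge0.
  by rewrite addrCA lerDl !addr_ge0.
apply: le_trans (ler_sum _ (fun b _ => outKE b)).
rewrite -big_distrl /= ler_wpM2r //.
rewrite divr_ge0 ?ler0n ?addr_ge0 ?ler01 //.
by apply: overlap_ge0 => a; exact: sent_state_posmx.
Qed.
End Attack.

(** * Choice of the round *)

Section Cut.
Variable C : numClosedFieldType.

(** On no qubits the space is one-dimensional, so both reduced states are the scalar 1. *)
Lemma sent_overlap_none n (c : commitment C n) (p : pred (com_qubit c)) :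
  (forall q, ~~ p q) -> sent_overlap p = 1.
Proof.
move=> pN; have all1 (s t : qubits {q | p q}) : s = t.
  by apply/ffunP => -[q pq]; case/negP: (pN q).
pose s0 : qubits {q | p q} := [ffun => false].
have trE (A : op C (qubits {q | p q})) : \tr A = ent A s0 s0.
  rewrite mxtraceE (bigD1 s0) //= big1 ?addr0 // => s /eqP[].
  exact: all1.
have st : sent_state p true = sent_state p false.
  apply: ent_ext => s t; rewrite (all1 s s0) (all1 t s0) -!trE.
  by rewrite !sent_state_trace.
rewrite /sent_overlap /overlap st sqrtmxK ?sent_state_trace //.
exact: sent_state_posmx.
Qed.

Lemma sent_overlap_all n (c : commitment C n) (p : pred (com_qubit c)) :
  (forall q, p q) -> sent_overlap p = 0.
Proof.
move=> pT; have all1 (s t : qubits {q | ~~ p q}) : s = t.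
  by apply/ffunP => -[q pq]; case/negP: (pq).
pose u0 : qubits {q | ~~ p q} := [ffun => false].
have sE a s t : ent (sent_state p a) s t =
    ent (com_state c a) (join t u0) (join s u0).
  rewrite entE (bigD1 u0) //= big1 ?addr0 ?entE // => u /eqP[].
  exact: all1.
(* The factors are in reverse order because [sent_state] transposes. *)
have rho0 : com_state c true *m com_state c false = 0.
  have [fpos _] := com_state_density c false.
  have [tpos _] := com_state_density c true.
  have ft : com_state c false *m com_state c true = 0.
    apply/matrixP => i j; have /matrixP/(_ 0 0) :=
      @com_state_orthogonal C n c (delta_mx i 0) (delta_mx j 0).
    rewrite adjmxM (posmx_adj fpos) trmx_delta map_delta_mx !mulmxA.
    by rewrite -[_ *m _ *m com_state c true]mulmxA -rowE -colE !mxE.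
  by rewrite -(posmx_adj fpos) -(posmx_adj tpos) -adjmxM ft trmx0 map_mx0.
have ss0 : sent_state p false *m sent_state p true = 0.
  apply: ent_ext => s t; rewrite ent_mul.
  have := congr1 (fun A => ent A (join t u0) (join s u0)) rho0.
  rewrite /= ent_mul (sum_regroup (@restrict_joinl _ p) (@restrict_joinr _ p)
    (@join_restrict _ p)).
  rewrite !ent0; apply: etrans; apply: eq_bigr => s' _.
  rewrite (bigD1 u0) //= big1 ?addr0 => [|u /eqP[]]; last exact: all1.
  by rewrite mulrC !sE.
have fpos := @sent_state_posmx C n c p false.
have tpos := @sent_state_posmx C n c p true.
rewrite /sent_overlap /overlap.
suff -> : sqrtmx (sent_state p false) *m sqrtmx (sent_state p true) = 0.
  exact: mxtrace0.
(* By cyclicity the Gram trace of the product of the roots is the trace of the product of the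
   states, which is 0. *)
apply: trace_gram_eq0; rewrite adjmxM (sqrtmx_adj fpos) (sqrtmx_adj tpos).
rewrite mulmxA -[_ *m _ *m sqrtmx (sent_state p false)]mulmxA (sqrtmxK fpos).
by rewrite -mulmxA mxtrace_mulC -mulmxA (sqrtmxK tpos) ss0 mxtrace0.
Qed.

Lemma opponentK X : opponent (opponent X) = X.
Proof. by case: X. Qed.

Lemma half_crossing (n : nat) (mover : nat -> party) (F : party -> nat -> C) :
  (forall X k, 0 <= F X k) ->
  (forall X, F X 0%N = 1) -> (forall X, F X n = 0) ->
  (forall k, (k < n)%N ->
     F (opponent (mover k)) k.+1 = F (opponent (mover k)) k) ->
  exists (k : 'I_n) (X : party), 2%:R^-1 <= F X k /\ F (opponent X) k <= 2%:R^-1.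
Proof.
move=> F_ge0 F0 Fn Fstep.
have half_ge0 : 0 <= 2%:R^-1 :> C by rewrite invr_ge0 ler0n.
have half_real : (2%:R^-1 : C) \is Num.real by exact: ger0_real.
have Freal X k : F X k \is Num.real by exact: ger0_real.
(* Induction on the round: until a crossing occurs both overlaps exceed one half. When the mover's
   overlap drops, the other is unchanged and still large, so the other player is the cheater. *)
have cut k : (k < n)%N -> (exists (k : 'I_n) (X : party),
    2%:R^-1 <= F X k /\ F (opponent X) k <= 2%:R^-1)
    \/ forall X, 2%:R^-1 < F X k.
  elim: k => [|k IHk] kn.
    by right=> X; rewrite F0 invf_lt1 ?ltr0n // ltr1n.
  have [|Fk] := IHk (ltnW kn); first by left.
  set Z := mover k; have FY : 2%:R^-1 < F (opponent Z) k.+1.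
    by rewrite Fstep ?Fk // ltnW.
  case: (real_leP (Freal Z k.+1) half_real) => FZ; last first.
    by right; move: FY FZ; case: (Z) => ? ? [].
  left; exists (Ordinal kn), (opponent Z); split; first exact: ltW.
  by rewrite opponentK.
case: n Fn Fstep cut => [|n] Fn Fstep cut.
  by have := F0 Alice; rewrite Fn => /eqP; rewrite eq_sym oner_eq0.
(* With no crossing before the end, the player idle in the last round would keep an overlap above
   one half, yet it is 0 at the end. So the crossing precedes a genuine round. *)
have [//|/(_ (opponent (mover n)))] := cut n (ltnSn n).
by rewrite -Fstep // Fn => /(le_lt_trans half_ge0); rewrite ltxx.
Qed.

End Cut.

(** * Strategies acting in a single round *)

Section Protocol.
Variables (C : numClosedFieldType) (P : protocol C).

Definition round_overlap (X : party) (k : nat) : C :=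
  sent_overlap (fun q : com_qubit (side P X) => (com_round q < k)%N).

(** By [side_turn], no qubit of the idle player is assigned to round [k]. *)
Lemma round_overlap_step k : (k < rounds P)%N ->
  round_overlap (opponent (turn (first P) k)) k.+1 =
  round_overlap (opponent (turn (first P) k)) k.
Proof.
set X := opponent _ => kn; congr (sent_overlap _); apply/boolp.funext => q.
rewrite ltnS leq_eqVlt; case: eqP => //= qk.
have := side_turn q; rewrite qk /X.
by case: (turn _ _).
Qed.

Lemma embed1 (W S T : finType) (p : pred S) (r : pred T) :
  embed (1%:M : op C (W * qubits {q | p q} * qubits {q | r q})%type) = 1%:M.
Proof.
apply: ent_ext => -[[w x] t] [[w' x'] t']; rewrite !entE /= !xpair_eqE.
have [_|_] /= := eqVneq w w'; last by rewrite if_same.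
rewrite !restrict_eqE.
have spl (Q : finType) (p' : pred Q) (y y' : qubits Q) :
    (y == y') = [forall q, ~~ p' q ==> (y q == y' q)]
                && [forall q, p' q ==> (y q == y' q)].
  apply/eqP/andP => [->|[/forallP np /forallP yp]].
    by split; apply/forallP => q; rewrite eqxx implybT.
  apply/ffunP => q; have := np q; have := yp q.
  by case: (p' q) => [/eqP|_ /eqP].
rewrite (spl S p x) (spl T r t).
by do 2![case: [forall _, _]; rewrite /= ?andbF ?andbT //].
Qed.

Lemma foldl_at (I : eqType) (T : Type) (f : T -> I -> T) (k : I) s z :
  uniq s -> k \in s -> (forall i y, i != k -> f y i = y) -> foldl f z s = f z k.
Proof.
move=> + + fid; elim: s z => //= i s IHs z /andP[is_ us]; rewrite inE.
case: (eqVneq k i) is_ => [<- ks _|ki _ /= ks]; last by rewrite fid 1?eq_sym // IHs.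
elim: s {IHs us} (f z k) ks => //= j s IHs y.
by rewrite inE negb_or => /andP[kj ks]; rewrite fid 1?eq_sym // IHs.
Qed.

Lemma protocol_attack (X : party) (k : 'I_(rounds P)) :
  exists s : strategy P X,
    (2%:R - round_overlap (opponent X) k) * ((1 + round_overlap X k) / 2%:R)
    <= 2%:R * outcome_prob s false.
Proof.
pose W := qubits (com_qubit (side P X)).
have att (i : 'I_(rounds P)) : exists prepKs :
    op C (W * qubits (com_qubit (side P X)))%type * seq (op C (lab X W i)),
  [/\ density prepKs.1, kraus_family prepKs.2
    & (2%:R - round_overlap (opponent X) i) * ((1 + round_overlap X i) / 2%:R) <=
      \sum_b pass_prob b (trace_out_ends
        (kraus_apply [seq embed K | K <- prepKs.2]
                     (tens prepKs.1 (com_state (side P (opponent X)) b))))].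
  (* The type of the Kraus operators depends on this predicate, so an equality of predicates is
     needed to transport them. *)
  have unsentE : unsent (X := X) i = (fun q => ~~ (com_round q < i)%N).
    by apply/boolp.funext => q; rewrite -leqNgt.
  have [prep [Ks KsP]] := attack
    (fun q : com_qubit (side P X) => (com_round q < i)%N) (received (X := X) i).
  rewrite /lab; move: unsentE => ->.
  by exists (prep, Ks).
have /(_ _)/boolp.cid-/all_tag[f fP] := att.
(* The identity operation is performed in every round but [k]. *)
have idK (i : 'I_(rounds P)) : kraus_family (if i == k then (f i).2 else [:: 1%:M]).
  case: eqP => _; first by case: (fP i).
  by rewrite /kraus_family big_seq1 adjmx1 mulmx1.
have [prepD _ win] := fP k.
exists (Strategy prepD idK).
rewrite /outcome_prob [X in _ <= X]mulrA divff ?pnatr_eq0 // mul1r.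
apply: le_trans win _; rewrite le_eqVlt; apply/orP; left; apply/eqP.
apply: eq_bigr => b _ /=.
rewrite /pass_prob /final_state /=.
rewrite (foldl_at (k := k)) ?enum_uniq ?mem_enum // ?eqxx // => i y /negPf ->.
by rewrite /kraus_apply big_seq1 embed1 adjmx1 mulmx1 mul1mx.
Qed.


Lemma round_overlap_ge0 X k : 0 <= round_overlap X k.
Proof. by apply: overlap_ge0 => a; exact: sent_state_posmx. Qed.

Lemma cheating_bound :
  exists (X : party) (v : bool) (s : strategy P X),
    9%:R / 16%:R <= outcome_prob s v.
Proof.
have [k [X [hX hY]]] : exists (k : 'I_(rounds P)) (X : party),
    2%:R^-1 <= round_overlap X k /\ round_overlap (opponent X) k <= 2%:R^-1.
  apply: (half_crossing (mover := turn (first P))).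
  - exact: round_overlap_ge0.
  - by move=> X; apply: sent_overlap_none => q; rewrite ltn0.
  - by move=> X; apply: sent_overlap_all => q; rewrite ltn_ord.
  - exact: round_overlap_step.
have [s win] := protocol_attack X k; exists X, false, s.
rewrite -(ler_pM2l (ltr0n C 2)); apply: le_trans win.
(* Twice 9/16 is 3/2 times 3/4, the value of the bound when both overlaps are one half; it decreases
   in the opponent's overlap and increases in the cheater's. *)
rewrite (_ : _ * (_ / _) = (2%:R - 2%:R^-1) * ((1 + 2%:R^-1) / 2%:R)); last by field.
apply: ler_pM.
- rewrite (_ : _ - _ = 3%:R / 2%:R); last by field.
  by rewrite divr_ge0 ?ler0n.
- by rewrite divr_ge0 ?addr_ge0 ?invr_ge0 ?ler0n ?ler01.
- by rewrite lerD2l lerN2.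
by rewrite ler_wpM2r ?invr_ge0 ?ler0n // lerD2l.
Qed.
End Protocol.

Local Open Scope complex_scope.

Theorem theorem2p2 (R : realType) (P : protocol R[i]) :
  exists (X : party) (v : bool) (s : strategy P X),
    9%:R / 16%:R <= outcome_prob s v.
Proof. exact: cheating_bound. Qed.
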